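(* Let $G$ and $H$ be finite simple graphs with $\operatorname{im}(G)=t$ and $\operatorname{im}(H)=r$. Then $\operatorname{im}(G\,\Box\, H)\geq t+r-1$.
   Context: All graphs are finite and simple. A graph $G$ has a $G'$-immersion if there is an injective map $\phi:V(G')\to V(G)$ such that for every edge $uv\in E(G')$ there is a path in $G$ joining $\phi(u)$ and $\phi(v)$, and these paths are pairwise edge-disjoint. The immersion number $\operatorname{im}(G)$ is the largest $t$ such that $G$ has a $K_t$-immersion. The Cartesian product $G\,\Box\, H$ has vertex set $V(G)\times V(H)$, with $(g,h)$ adjacent to $(g',h')$ if and only if either $g=g'$ and $hh'\in E(H)$, or $gg'\in E(G)$ and $h=h'$. *)

(* Defs.v *)
From mathcomp Require Import all_boot.
From mathcomp Require Import boolp.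

Set Implicit Arguments.
Unset Strict Implicit.
Unset Printing Implicit Defensive.

Record sgraph := SGraph {
  vertex :> finType;
  adj : rel vertex;
  adj_sym : symmetric adj;
  adj_irrefl : irreflexive adj
}.

Definition edges (G : sgraph) : {set {set G}} :=
  [set [set e.1; e.2] | e : G * G & adj e.1 e.2].

Definition complete_adj (n : nat) : rel 'I_n := fun i j => i != j.

Lemma complete_adj_sym n : symmetric (@complete_adj n).
Proof. by move=> i j; rewrite /complete_adj eq_sym. Qed.

Lemma complete_adj_irrefl n : irreflexive (@complete_adj n).
Proof. by move=> i; rewrite /complete_adj eqxx. Qed.

Definition complete (n : nat) : sgraph :=
  SGraph (@complete_adj_sym n) (@complete_adj_irrefl n).

Definition cart_adj (G H : sgraph) : rel (G * H) := fun x y =>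
  (x.1 == y.1) && adj x.2 y.2 || adj x.1 y.1 && (x.2 == y.2).

Lemma cart_adj_sym G H : symmetric (@cart_adj G H).
Proof.
move=> x y; rewrite /cart_adj (eq_sym x.1) (eq_sym x.2).
by rewrite (adj_sym x.1) (adj_sym x.2).
Qed.

Lemma cart_adj_irrefl G H : irreflexive (@cart_adj G H).
Proof. by move=> x; rewrite /cart_adj !adj_irrefl andbF. Qed.

Definition cart (G H : sgraph) : sgraph :=
  SGraph (@cart_adj_sym G H) (@cart_adj_irrefl G H).

(* A path is the nonempty sequence of its vertices; since it is attached to an
   unordered edge, it may be listed from either end. *)
Definition path_joining (G : sgraph) (x y : G) (p : seq G) : bool :=
  if p is z :: q then
    [&& path (@adj G) z q, uniq p
      & (z == x) && (last z q == y) || (z == y) && (last z q == x)]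
  else false.

Definition path_edges (G : sgraph) (p : seq G) : seq {set G} :=
  if p is z :: q then pairmap (fun a b => [set a; b]) z q else [::].

Definition has_immersion (G G' : sgraph) : Prop :=
  exists (phi : G' -> G) (P : {set G'} -> seq G),
    [/\ injective phi,
        forall u v : G', adj u v ->
          path_joining (phi u) (phi v) (P [set u; v])
      & forall e f : {set G'}, e \in edges G' -> f \in edges G' -> e != f ->
          [disjoint path_edges (P e) & path_edges (P f)]].

(* The range t <= #|G| loses nothing, as phi is injective: see imP. *)
Definition im (G : sgraph) : nat :=
  \max_(t < #|G|.+1 | `[< has_immersion G (complete t) >]) t.

Lemma has_immersion0 (G : sgraph) : has_immersion G (complete 0).
Proof.
exists (fun i : 'I_0 => False_rect G (notF (valP i))), (fun=> [::]).
by split=> [[]|[]|e f /imsetP[[[]]]].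
Qed.

Lemma imP (G : sgraph) (t : nat) :
  im G = t <->
  has_immersion G (complete t) /\
  (forall s, has_immersion G (complete s) -> s <= t).
Proof.
have im_max s : has_immersion G (complete s) -> s <= im G.
  move=> Gs; have s_le : s < #|G|.+1.
    have [phi [_ [phi_inj _ _]]] := Gs.
    by have := leq_card phi phi_inj; rewrite card_ord ltnS.
  apply: (@leq_bigmax_cond _ _ (fun i : 'I_#|G|.+1 => i : nat) (Ordinal s_le)).
  exact/asboolP.
have im_imm : has_immersion G (complete (im G)).
  rewrite /im; elim/big_ind: _ => [|m n Gm Gn|i /asboolP //].
    exact: has_immersion0.
  by rewrite /maxn; case: ifP.
split=> [<- //|[Gt t_max]].
by apply/eqP; rewrite eqn_leq t_max // im_max.
Qed.

(* Main.v *)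
Require Import Defs.
From mathcomp Require Import all_boot.

(** Let [g_i] ([i < t]) and [h_k] ([k < r]) be the terminals of complete
    immersions in [G] and [H], with paths [P_ij] and [Q_kl]. The [t + r - 1]
    vertices [(g_i, h_0)] and [(g_0, h_k)] are the terminals of a complete
    immersion in [cart G H]: two terminals in the layer of [h_0] (or of [g_0])
    are joined inside that layer by a copy of [P_ij] (or [Q_kl]), while
    [(g_i, h_0)] and [(g_0, h_k)] are joined through [(g_i, h_k)], by the copy
    of [Q_0k] over [g_i] followed by the copy of [P_i0] over [h_k].

    Only the edges used matter for disjointness: a system of edge-disjoint paths
    is the same thing as a system of disjoint symmetric subrelations of the
    adjacency relation, each connecting its two terminals. *)

Set Implicit Arguments.
Unset Strict Implicit.
Unset Printing Implicit Defensive.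

(** * Complete immersions as systems of disjoint relations *)

(** The index is an ordered pair, but [routing_disjoint] separates only distinct unordered pairs, so
    [E u v] and [E v u] may overlap. By [routing_neq] the diagonal relations are empty. *)
Record clique_routing (G : sgraph) (n : nat) (phi : 'I_n -> G)
    (E : 'I_n -> 'I_n -> rel G) : Prop := CliqueRouting {
  routing_inj : injective phi;
  routing_sym : forall u v, symmetric (E u v);
  routing_adj : forall u v, subrel (E u v) (@adj G);
  routing_neq : forall u v x y, E u v x y -> u != v;
  routing_connect : forall u v, connect (E u v) (phi u) (phi v);
  routing_disjoint : forall u v u' v' x y,
    E u v x y -> E u' v' x y -> [set u; v] = [set u'; v']
}.

Lemma path_pairmap (T : eqType) (S : eqType) (f : T -> T -> S) (e : rel T) z q :
  path e z q -> path [rel x y | e x y && (f x y \in pairmap f z q)] z q.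
Proof.
elim: q z => //= a q IHq z /andP[eza /IHq aq].
rewrite eza mem_head /=; apply: sub_path aq => x y /= /andP[-> fxy].
by rewrite inE fxy orbT.
Qed.

Lemma pairmap_path_mem (T : Type) (S : eqType) (f : T -> T -> S) (e : rel T)
    z q s :
  path e z q -> s \in pairmap f z q -> exists x y, s = f x y /\ e x y.
Proof.
elim: q z => //= a q IHq z /andP[eza /IHq aq].
by rewrite inE => /predU1P[->|//]; exists z, a.
Qed.

Lemma set2_eq (T : finType) (a b c d : T) :
  [set a; b] = [set c; d] -> (a = c /\ b = d) \/ (a = d /\ b = c).
Proof.
move=> eqS.
have: a \in [set c; d] by rewrite -eqS set21.
have: b \in [set c; d] by rewrite -eqS set22.
have: c \in [set a; b] by rewrite eqS set21.
have: d \in [set a; b] by rewrite eqS set22.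
rewrite !inE.
by do 4![case/orP => /eqP ?]; subst; auto.
Qed.

Lemma mem_edges_complete n (u v : 'I_n) :
  u != v -> [set u; v] \in edges (complete n).
Proof.
by move=> uv; apply/imsetP; exists (u, v); rewrite ?inE.
Qed.

Lemma immersion_routing (G : sgraph) n :
  has_immersion G (complete n) -> exists phi E, @clique_routing G n phi E.
Proof.
move=> [phi [P [phi_inj Pjoin Pdisj]]].
(* Nothing constrains [P] on singletons, hence the guard [u != v]. *)
pose E (u v : 'I_n) : rel G := [rel x y |
  [&& u != v, adj x y & [set x; y] \in path_edges (P [set u; v])]].
have Esym u v : symmetric (E u v).
  by move=> x y; rewrite /E /= adj_sym setUC.
exists phi, E; split=> // [u v x y /and3P[]//|u v x y /and3P[]//|u v|].
  have [<-|uv] := eqVneq u v; first exact: connect0.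
  have := Pjoin u v uv; rewrite /path_joining; case DP: (P _) => [//|z q].
  case/and3P=> zq _ ends.
  have czq : connect (E u v) z (last z q).
    apply/connectP; exists q => //.
    apply: sub_path (path_pairmap (fun a b => [set a; b]) zq) => x y /=.
    by rewrite /E /= uv DP.
  case/orP: ends => /andP[/eqP<- /eqP<-] //.
  by rewrite (sym_connect_sym (Esym u v)).
move=> u v u' v' x y /and3P[uv _ xyP] /and3P[uv' _ xyP'].
apply/eqP/negPn/negP => neq.
have := Pdisj _ _ (mem_edges_complete uv) (mem_edges_complete uv') neq.
by move/disjointFr/(_ xyP); rewrite xyP'.
Qed.

Lemma routing_immersion (G : sgraph) n phi E :
  @clique_routing G n phi E -> has_immersion G (complete n).
Proof.
case=> phi_inj Esym Eadj Eneq Econn Edisj.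
have /fin_all_exists[p pP] (uv : 'I_n * 'I_n) : exists q,
    [/\ path (E uv.1 uv.2) (phi uv.1) q, last (phi uv.1) q = phi uv.2
      & uniq (phi uv.1 :: q)].
  have /connectP[q0 pq0 ->] := Econn uv.1 uv.2.
  by case/shortenP: pq0 => q pq uq _; exists q.
(* An unordered pair gets the path of whichever orientation [pick] finds; [path_joining] accepts
   both. *)
pose ends (e : {set complete n}) : option ('I_n * 'I_n) :=
  [pick uv : 'I_n * 'I_n | e == [set uv.1; uv.2]].
pose P e : seq G := if ends e is Some uv then phi uv.1 :: p uv else [::].
exists phi, P; split=> // [u v _|e f].
  rewrite /P /ends; case: pickP => [[u' v'] /= /eqP eqS|/(_ (u, v))]; last first.
    by rewrite eqxx.
  have [/= pq lq ->] := pP (u', v').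
  rewrite (sub_path (@Eadj u' v') pq) lq.
  by case: (set2_eq eqS) => -[-> ->]; rewrite !eqxx ?orbT.
move=> _ _; apply: contraNT => /pred0Pn[s /andP[/=]].
rewrite /P /ends; case: pickP => // uv /eqP-> se; case: pickP => // uv' /eqP-> sf.
have [puv _ _] := pP uv; have [puv' _ _] := pP uv'.
have [x [y [sE Exy]]] := pairmap_path_mem puv se.
have [x' [y' [sE' Exy']]] := pairmap_path_mem puv' sf.
apply/eqP/(Edisj _ _ _ _ x y Exy).
(* The two paths may cross their common edge in opposite directions. *)
have /set2_eq[[-> ->]//|[-> ->]] : [set x; y] = [set x'; y'] by rewrite -sE.
by rewrite Esym.
Qed.

(** * Index pairs on the two axes *)

(* Meant as [maxn k l] with [k] or [l] zero: the value is irrelevant when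
   neither is, as the part of the route lying in that layer is then empty. *)
Definition layer n (k l : 'I_n.+1) : 'I_n.+1 := if k == ord0 then l else k.

Lemma layer0 n (k : 'I_n.+1) : layer k ord0 = k.
Proof. by rewrite /layer; case: eqP. Qed.

Lemma layerC n (k l : 'I_n.+1) :
  k = ord0 \/ l = ord0 -> layer k l = layer l k.
Proof. by case=> ->; rewrite layer0. Qed.

(** Since [i != j], one of them is nonzero, which forces the second coordinate beside it to vanish
    in both pairs; [layer] then returns the other one. *)
Lemma layer_inj m n (i j : 'I_m.+1) (k l k' l' : 'I_n.+1) :
  i != j -> i = ord0 \/ k = ord0 -> j = ord0 \/ l = ord0 ->
  i = ord0 \/ k' = ord0 -> j = ord0 \/ l' = ord0 ->
  layer k l = layer k' l' -> k = k' /\ l = l'.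
Proof.
have [-> | /eqP i0] := eqVneq i ord0.
  rewrite eq_sym => /eqP j0 _ [//|->] _ [//|->].
  by rewrite !layer0.
by move=> _ [//|->] _ [//|->] _; rewrite /layer eqxx.
Qed.

(** Two routes sharing an edge of a layer agree in [[set i; j]] and in the layer; this recovers the
    unordered pair of terminals. *)
Lemma axis_pair_eq m n (i j i' j' : 'I_m.+1) (k l k' l' : 'I_n.+1) :
  i != j -> i = ord0 \/ k = ord0 -> j = ord0 \/ l = ord0 ->
  i' = ord0 \/ k' = ord0 -> j' = ord0 \/ l' = ord0 ->
  [set i; j] = [set i'; j'] -> layer k l = layer k' l' ->
  [/\ i = i', k = k', j = j' & l = l'] \/ [/\ i = j', k = l', j = i' & l = k'].
Proof.
move=> ij zu zv zu' zv' /set2_eq[] [Di Dj] eq_layer; subst i' j'.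
  by left; have [-> ->] := layer_inj ij zu zv zu' zv' eq_layer.
(* In the crosswise match, [i] and [j] are not both zero, so one of [k'], [l'] is. *)
have zk : k' = ord0 \/ l' = ord0.
  case: zu' zv' => [jz|]; last by left.
  by case=> [iz|]; [rewrite iz jz eqxx in ij | right].
rewrite (layerC zk) in eq_layer.
by right; have [-> ->] := layer_inj ij zu zv zv' zu' eq_layer.
Qed.

(** * The routing in the Cartesian product *)

Section CartRouting.

Variables (G H : sgraph) (t r : nat).
Variables (g : 'I_t.+1 -> G) (EG : 'I_t.+1 -> 'I_t.+1 -> rel G).
Variables (h : 'I_r.+1 -> H) (EH : 'I_r.+1 -> 'I_r.+1 -> rel H).
Hypotheses (routeG : clique_routing g EG) (routeH : clique_routing h EH).

(** Lifting [k] past [ord0] keeps the common corner of the axes from being counted twice. *)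
Definition axis_index (x : 'I_(t.+1 + r)) : 'I_t.+1 * 'I_r.+1 :=
  match split x with
  | inl i => (i, ord0)
  | inr k => (ord0, lift ord0 k)
  end.

Lemma axis_index_inj : injective axis_index.
Proof.
move=> x y; rewrite /axis_index => eq_xy.
apply: (can_inj (@splitK t.+1 r)).
case: (split x) (split y) eq_xy => [i|k] [j|l] //= [].
- by move=> ->.
- by move/val_inj->.
Qed.

Lemma axis_indexP x : (axis_index x).1 = ord0 \/ (axis_index x).2 = ord0.
Proof. by rewrite /axis_index; case: split => [i|k]; [right|left]. Qed.

Definition cart_terminal x : cart G H := (g (axis_index x).1, h (axis_index x).2).

(** For terminals on a common axis, the disjunct of the other factor is empty, being a diagonal
    relation. *)
Definition cart_route (u v : 'I_(t.+1 + r)) : rel (cart G H) := fun p q =>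
  let: (i, k) := axis_index u in let: (j, l) := axis_index v in
  [&& p.2 == h (layer k l), q.2 == h (layer k l) & EG i j p.1 q.1]
  || [&& p.1 == g (layer i j), q.1 == g (layer i j) & EH k l p.2 q.2].

Lemma cart_clique_routing : clique_routing cart_terminal cart_route.
Proof.
have [g_inj Gsym Gadj Gneq Gconn Gdisj] := routeG.
have [h_inj Hsym Hadj Hneq Hconn Hdisj] := routeH.
have Girr i x y : EG i i x y = false.
  by apply/negP => /Gneq; rewrite eqxx.
have Hirr i x y : EH i i x y = false.
  by apply/negP => /Hneq; rewrite eqxx.
have Rsym u v : symmetric (cart_route u v).
  move=> p q; rewrite /cart_route.
  case: (axis_index u) (axis_index v) => [i k] [j l].
  by rewrite Gsym Hsym; congr (_ || _); apply: andbCA.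
split=> //.
- move=> x y [] /g_inj eq1 /h_inj eq2; apply: axis_index_inj.
  by rewrite [LHS]surjective_pairing eq1 eq2 -surjective_pairing.
- move=> u v p q; rewrite /cart_route /= /cart_adj.
  case: (axis_index u) (axis_index v) => [i k] [j l].
  case/orP=> /and3P[/eqP-> /eqP->]; rewrite eqxx.
    by move/Gadj->; rewrite orbT.
  by move/Hadj->.
- move=> u v p q Euv; apply: contraTneq Euv => ->; rewrite /cart_route.
  by case: (axis_index v) => [j l]; rewrite Girr Hirr !andbF.
- move=> u v.
  have Hor i k j l : axis_index u = (i, k) -> axis_index v = (j, l) ->
      forall a b, connect (EG i j) a b ->
      connect (cart_route u v) (a, h (layer k l)) (b, h (layer k l)).
    move=> Du Dv a b /connectP[q pq ->].
    elim: q a pq => [|c q IHq] a /=; first by rewrite connect0.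
    case/andP=> Eac /IHq; apply: connect_trans; apply: connect1.
    by rewrite /cart_route Du Dv /= !eqxx Eac.
  have Ver i k j l : axis_index u = (i, k) -> axis_index v = (j, l) ->
      forall a b, connect (EH k l) a b ->
      connect (cart_route u v) (g (layer i j), a) (g (layer i j), b).
    move=> Du Dv a b /connectP[q pq ->].
    elim: q a pq => [|c q IHq] a /=; first by rewrite connect0.
    case/andP=> Eac /IHq; apply: connect_trans; apply: connect1.
    by rewrite /cart_route Du Dv /= !eqxx Eac orbT.
  move: Hor Ver; rewrite /cart_terminal.
  have := axis_indexP u; have := axis_indexP v.
  case: (axis_index u) (axis_index v) => [i k] [j l] /= zv zu Hor Ver.
  have {Hor} Hor := Hor _ _ _ _ erefl erefl _ _ (Gconn i j).
  have {Ver} Ver := Ver _ _ _ _ erefl erefl _ _ (Hconn k l).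
  (* The route turns at [(g i, h l)] if [i] is nonzero and at [(g j, h k)] if [k] is; from the
     common corner, one of [Hor] and [Ver] suffices. *)
  have [k0|k0] := eqVneq k ord0.
    subst k; move: Hor Ver; rewrite {1 2}/layer eqxx => Hor.
    have [i0|i0] := eqVneq i ord0; last first.
      by rewrite /layer (negPf i0) => /connect_trans; apply.
    subst i; rewrite /layer eqxx => Ver.
    by case: zv => ?; subst.
  case: zu => [i0|/eqP]; last by rewrite (negPf k0).
  subst i; move: Hor Ver; rewrite /layer eqxx (negPf k0).
  exact: connect_trans.
- move=> u v u' v' p q Euv Euv'.
  suff [[/axis_index_inj-> /axis_index_inj->] //|
        [/axis_index_inj-> /axis_index_inj->]] :
      (axis_index u = axis_index u' /\ axis_index v = axis_index v') \/
      (axis_index u = axis_index v' /\ axis_index v = axis_index u').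
    exact: setUC.
  (* Edges of a copy of [G] change the first coordinate, those of a copy of [H] keep it, so copies
     of different factors share no edge. *)
  have Gpq i j : EG i j p.1 q.1 -> p.1 != q.1.
    by move/Gadj; apply: contraTneq => ->; rewrite adj_irrefl.
  have Hpq k l : EH k l p.2 q.2 -> p.2 != q.2.
    by move/Hadj; apply: contraTneq => ->; rewrite adj_irrefl.
  move: (axis_indexP u) (axis_indexP v) (axis_indexP u') (axis_indexP v').
  move: Euv Euv'; rewrite /cart_route.
  case: (axis_index u) (axis_index v) => [i k] [j l].
  case: (axis_index u') (axis_index v') => [i' k'] [j' l'] /=.
  case/orP=> /and3P[/eqP p1 /eqP q1 E1] /orP[] /and3P[/eqP p2 /eqP q2 E2].
  + move=> zu zv zu' zv'; move: p2; rewrite p1 => /h_inj eq_layer.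
    have eq_set := Gdisj _ _ _ _ _ _ E1 E2.
    have := axis_pair_eq (Gneq _ _ _ _ E1) zu zv zu' zv' eq_set eq_layer.
    by case=> -[-> -> -> ->]; [left|right].
  + by have := Gpq _ _ E1; rewrite p2 q2 eqxx.
  + by have := Hpq _ _ E1; rewrite p2 q2 eqxx.
  (* The first case with the two axes exchanged. *)
  + move=> /or_comm zu /or_comm zv /or_comm zu' /or_comm zv'.
    move: p2; rewrite p1 => /g_inj eq_layer.
    have eq_set := Hdisj _ _ _ _ _ _ E1 E2.
    have := axis_pair_eq (Hneq _ _ _ _ E1) zu zv zu' zv' eq_set eq_layer.
    by case=> -[-> -> -> ->]; [left|right].
Qed.

End CartRouting.

Lemma has_immersion1 (G : sgraph) : 0 < #|G| -> has_immersion G (complete 1).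
Proof.
case/card_gt0P=> x _; exists (fun=> x), (fun=> [::]).
split=> [u v _|u v|e f /imsetP[[u v]]]; first by rewrite (ord1 u) (ord1 v).
  by rewrite (ord1 u) (ord1 v) adj_irrefl.
by rewrite inE (ord1 u) (ord1 v) adj_irrefl.
Qed.

Theorem theorem9 (G H : sgraph) (t r : nat) (G_nonempty : 0 < #|G|)
  (H_nonempty : 0 < #|H|) (imG : im G = t) (imH : im H = r) :
  t + r - 1 <= im (cart G H).
Proof.
have [Gt t_max] := (imP G t).1 imG; have [Hr r_max] := (imP H r).1 imH.
(* Both numbers are at least 1, so they are successors and the terminals indexed by [ord0] exist. *)
have := t_max 1 (has_immersion1 G_nonempty).
have := r_max 1 (has_immersion1 H_nonempty).
case: t r Gt Hr {imG imH t_max r_max} => [|t] [|r] // Gt Hr _ _.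
have [g [EG routeG]] := immersion_routing Gt.
have [h [EH routeH]] := immersion_routing Hr.
have [_] := (imP (cart G H) _).1 erefl; apply.
rewrite addnS subn1.
exact: routing_immersion (cart_clique_routing routeG routeH).
Qed.
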